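(* Let $V,U,T,\mathcal{F}$ be as in the setting described in the context, and let $(X,\|\cdot\|_X)$ and $(X',\|\cdot\|_{X'})$ be any two Banach spaces that are admissible in the sense described in the context. Then $f^*$ is an $X$-local minimiser of $\mathcal{F}$ if and only if it is an $X'$-local minimiser of $\mathcal{F}$.
   Context: Setting: $(V,\|\cdot\|_V)$ is a Banach space, $U\subset V$, and $T:V\to\mathbb{R}^k$ is a continuous linear operator. $\mathcal{F}:U\to\mathbb{R}\cup\{+\infty\}$ is bounded below, coercive and lower semicontinuous with respect to the weak topology of $V$. For $b\in TU$ let $A(b)=\{f\in U:Tf=b\}$, and let $D=\{Tf:f\in U,\ \mathcal{F}(f)<+\infty\}$. For each $b\in D$, $A(b)$ is convex and $\mathcal{F}$ is strictly convex on $A(b)$ (on its effective domain). For $b\in D$ the minimisation of $\mathcal{F}$ over $A(b)$ has a unique solution, denoted $T^{-1}(b)=\arg\min_{f\in A(b)}\mathcal{F}(f)$; this defines a right inverse $T^{-1}:D\to V$ of $T$. Put $U_{\mathcal{F}}=T^{-1}D$. A Banach space $(X,\|\cdot\|_X)$ is admissible if $U_{\mathcal{F}}\subset X\subset V$, the topology induced by $\|\cdot\|_X$ on $X$ is at least as strong as that induced by $\|\cdot\|_V$, and $T^{-1}:D\to X$ is continuous with respect to $\|\cdot\|_X$. An element $f^*\in U\cap X$ with $\mathcal{F}(f^* )<+\infty$ is an $X$-local minimiser of $\mathcal{F}$ if there is $\epsilon>0$ such that $\mathcal{F}(f^* )\le\mathcal{F}(f)$ for all $f\in U\cap X$ with $\|f-f^*\|_X<\epsilon$.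 *)

(* Defs.v *)
From HB Require Import structures.
From mathcomp Require Import all_boot all_order all_algebra.
From mathcomp Require Import all_classical all_reals all_analysis.
From mathcomp Require Import lra.
Set Implicit Arguments.
Unset Strict Implicit.
Unset Printing Implicit Defensive.
Import Order.TTheory GRing.Theory Num.Theory.
Import numFieldNormedType.Exports.
Local Open Scope classical_set_scope.
Local Open Scope ring_scope.

Section WeakTopology.
Context {R : realType} (V : normedModType R).

(* V with the coarsest topology making all continuous linear functionals
   continuous. *)
Definition weak_space : topologicalType :=
  sup_topology (fun phi : {phi : {linear V -> R^o} | continuous phi} =>
    Topological.on (initial_topology (sval phi : V -> R^o))).

End WeakTopology.

(* A functional U -> R ∪ {+oo} on a subset U of V is represented by a function
   F : V -> \bar R; all the definitions below only use its values on U.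
   The value -oo is excluded on U by bounded_below. *)
Section Functional.
Context {R : realType} {V : normedModType R}.
Implicit Types (U A : set V) (F : V -> \bar R).
Local Open Scope ereal_scope.

Definition bounded_below U F := exists m : R, forall f, U f -> m%:E <= F f.

(* Sublevel sets are relatively compact in U for the weak topology. *)
Definition weakly_coercive U F := forall c : R,
  exists K : set (weak_space V),
    [/\ compact K, K `<=` U & [set f | U f /\ F f <= c%:E] `<=` K].

(* Lower semicontinuity on U, with the topology induced by the weak one. *)
Definition weakly_lsc U F :=
  lower_semicontinuous (F : subspace (U : set (weak_space V)) -> \bar R).

(* Strict convexity on the intersection of A with the effective domain. *)
Definition strictly_convex_on A F := forall (f g : V) (t : R),
  A f -> A g -> F f < +oo -> F g < +oo -> f != g -> (0 < t < 1)%R ->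
  F (t *: f + (1 - t) *: g)%R < t%:E * F f + (1 - t)%:E * F g.

End Functional.

Section RightInverse.
Context {R : realType} {V : normedModType R} {k : nat}.
Variables (U : set V) (T : {linear V -> 'rV[R]_k}) (F : V -> \bar R).
Local Open Scope ereal_scope.

Definition fibre (b : 'rV[R]_k) : set V := [set f | U f /\ T f = b].

Definition feasible : set 'rV[R]_k :=
  [set T f | f in [set f | U f /\ F f < +oo]].

Definition argmin (b : 'rV[R]_k) : set V :=
  [set f | fibre b f /\ forall g, fibre b g -> F f <= F g].

(* On the feasible set this is the only element of argmin b, by
   right_inverseP below; elsewhere it is junk. *)
Definition right_inverse (b : 'rV[R]_k) : V := get (argmin b).

End RightInverse.

Section RightInverseTheory.
Context {R : realType} {V : normedModType R} {k : nat}.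
Variables (U : set V) (T : {linear V -> 'rV[R]_k}) (F : V -> \bar R).

Lemma weak_space_continuous (phi : {linear V -> R^o}) :
  continuous phi -> continuous (phi : weak_space V -> R^o).
Proof.
move=> cphi x.
have /cvg_sup/(_ (exist _ phi cphi)) h : nbhs (x : weak_space V) --> x by [].
apply: cvg_trans (@initial_continuous _ _ (phi : V -> R^o) x).
by move=> A; apply: h.
Qed.

Lemma weak_space_closed_fibre (p : V) (b : 'rV[R]_k) : continuous T ->
  T p != b -> nbhs (p : weak_space V) [set f | T f != b].
Proof.
move=> cT Tpb.
have [j Hj] : exists j, T p ord0 j != b ord0 j.
  apply/existsP; apply: contraNT Tpb; rewrite negb_exists => /forallP h.
  by apply/eqP/rowP => j; apply/eqP; have := h j; rewrite negbK.
pose phi (f : V) : R^o := T f ord0 j.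
have phi_lin : linear phi by move=> a x y; rewrite /phi linearP !mxE.
pose phiM := GRing.isLinear.Build R V R^o *:%R phi phi_lin.
pose phiL : {linear V -> R^o} := HB.pack phi phiM.
have cphi : continuous phiL.
  move=> x; apply: (@continuous_comp _ _ _ T (fun M : 'rV[R]_k => M ord0 j)).
    exact: cT.
  exact: coord_continuous.
have op : nbhs (phi p) [set x : R^o | x != b ord0 j].
  have oN : open ([set x | x != b ord0 j] : set R^o) by exact: open_neq.
  exact: open_nbhs_nbhs.
have op' := @weak_space_continuous phiL cphi p _ op.
apply: (@filterS _ (nbhs (p : weak_space V)) (nbhs_filter _) _ _ _ op') => f /=.
by apply: contraNN => /eqP <-.
Qed.

Lemma argmin_nonempty b : continuous T -> bounded_below U F ->
    weakly_coercive U F -> weakly_lsc U F -> feasible U T F b ->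
  argmin U T F b !=set0.
Proof.
move=> cT [m mF] coF lscF [f0 [Uf0 Ff0] Tf0].

have [c Ec] : exists c : R, F f0 = c%:E.
  have := mF _ Uf0; case: (F f0) Ff0 => [c| |]//; first by exists c.
pose A := fibre U T b.
pose I := ereal_inf (F @` A).
have Af0 : A f0 by [].
have Ic : (I <= c%:E)%E by apply: ereal_inf_lbound; exists f0.
have [cI|/negP cI] := boolP (c%:E <= I)%E.
  exists f0; split => // g Ag; rewrite Ec (le_trans cI)//.
  by apply: ereal_inf_lbound; exists g.
have ltIc : (I < c%:E)%E by rewrite ltNge; apply/negP.
have [K [cK KU sK]] := coF c.
pose D := [set a : R | (I < a%:E)%E].
pose M a : set V := [set f | A f /\ (F f <= a%:E)%E].
have MF : Filter (filter_from D M).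
  apply: filter_from_filter; first by exists c.
  move=> a a' Da Da'; exists (Num.min a a').
    by rewrite /D/= EFin_min lt_min; apply/andP.
  move=> f [Af]; rewrite EFin_min le_min => /andP[? ?]; by split.
have PF : ProperFilter (filter_from D M).
  apply: filter_from_proper => a Da.
  have : ~ (a%:E <= I)%E by apply/negP; rewrite -ltNge.
  move=> h; apply: contrapT => h'; apply: h; apply/ereal_infP => _ [f Af <-].
  rewrite leNgt; apply/negP => Ffa; apply: h'; exists f; split => //; exact: ltW.
have FK : filter_from D M K.
  by exists c => // f [[Uf _] Ffc]; apply: sK.
have [p [Kp clp]] := cK _ PF FK.
have Up := KU _ Kp.
exists p; split.
  split => //; apply/eqP; apply: contrapT => /negP Tpb.
  have FM : filter_from D M (M c) by exists c.
  have [f [[[_ Tf] _] /=]] := clp _ _ FM (weak_space_closed_fibre cT Tpb).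
  by rewrite Tf eqxx.
move=> g Ag; apply: (@le_trans _ _ I); last by apply: ereal_inf_lbound; exists g.
rewrite leNgt; apply/negP => IFp.
have [a Ia aFp] : exists2 a : R, (I < a%:E)%E & (a%:E < F p)%E.
  have [mI|] := boolP (m%:E <= I)%E; last first.
    by move/negP; case; apply/ereal_infP => _ [f [Uf _] <-]; exact: mF.
  case: (F p) IFp => [r| |] //; case: I mI {Ic cI ltIc D M MF PF FK clp} => [s| |] //.
  - move=> _; rewrite lte_fin => sr; exists ((s + r) / 2); rewrite lte_fin; lra.
  - by move=> _ _; exists (s + 1); rewrite ?ltry// lte_fin; lra.
have [N + NF] := lscF _ _ aFp.
rewrite /nbhs /= -nbhs_subspace_in// => pN.
have FM : filter_from D M (M a) by exists a.
have [f [[[Uf _] Ffa] Nf]] := clp _ _ FM pN.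
by have := NF _ (Nf Uf); rewrite ltNge Ffa.
Qed.

Lemma argmin_unique b : bounded_below U F ->
    (forall b, feasible U T F b -> convex_set (fibre U T b)) ->
    (forall b, feasible U T F b -> strictly_convex_on (fibre U T b) F) ->
  feasible U T F b -> forall f g, argmin U T F b f -> argmin U T F b g -> f = g.
Proof.
move=> [m mF] cv scv fb f g [Af mf] [Ag mg]; apply/eqP; apply: contrapT => /negP fg.
have [f0 [Uf0 Ff0] Tf0] := fb.
have Ff : (F f < +oo)%E by apply: le_lt_trans Ff0; apply: mf.
have Fg : (F g < +oo)%E by apply: le_lt_trans Ff0; apply: mg.
have efg : F f = F g by apply/eqP; rewrite eq_le mf//= mg.
have h : 0 < (2^-1 : R) < 1 by lra.
have := scv _ fb f g 2^-1 Af Ag Ff Fg fg h.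
have i01 : Itv.spec (@Itv.num_sem R) (Itv.Real `[0%Z, 1%Z]) (2^-1 : R).
  by rewrite /= /Itv.num_sem/= num_real /= in_itv/=; lra.
have := cv _ fb f g (Itv.mk i01); rewrite !inE => /(_ Af Ag) Ac.
rewrite -efg; have := mf _ Ac.
have := mF _ Af.1; case: (F f) Ff => [r| |]// _ _; rewrite /conv /= => h1 h2.
have := le_lt_trans h1 h2; rewrite -!EFinM -EFinD lte_fin; lra.
Qed.

Lemma right_inverseP b : continuous T -> bounded_below U F ->
    weakly_coercive U F -> weakly_lsc U F ->
    (forall b, feasible U T F b -> convex_set (fibre U T b)) ->
    (forall b, feasible U T F b -> strictly_convex_on (fibre U T b) F) ->
  feasible U T F b ->
  argmin U T F b (right_inverse U T F b) /\
  forall f, argmin U T F b f -> f = right_inverse U T F b.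
Proof.
move=> cT bF coF lscF cv scv fb.
have am : argmin U T F b (right_inverse U T F b).
  by apply: getPex; exact: argmin_nonempty.
by split=> // f af; exact: argmin_unique fb _ _ af am.
Qed.

End RightInverseTheory.

Section Admissible.
Context {R : realType} {V : normedModType R} {k : nat}.
Variables (U : set V) (T : {linear V -> 'rV[R]_k}) (F : V -> \bar R).

(* A Banach space X contained in V is given by its inclusion map
   i : {linear X -> V}; X as a subset of V is range i. *)
Record admissible (X : completeNormedModType R) (i : {linear X -> V}) : Prop :=
  Admissible {
    admissible_inj : injective i ;
    admissible_sub : right_inverse U T F @` feasible U T F `<=` range i ;
    admissible_stronger : continuous i ;
    (* the corestriction to X of the right inverse, which is unique on the
       feasible set, is continuous there *)
    admissible_right_inverse : exists s : 'rV[R]_k -> X,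
      (forall b, feasible U T F b -> i (s b) = right_inverse U T F b) /\
      {within feasible U T F, continuous s} }.

Definition local_minimiser (X : completeNormedModType R) (i : {linear X -> V})
    (fstar : V) : Prop :=
  exists x : X, [/\ i x = fstar, U fstar, (F fstar < +oo)%E &
    exists2 e : R, 0 < e & forall y : X,
      U (i y) -> `|y - x| < e -> (F fstar <= F (i y))%E].

End Admissible.

(* Main.v *)
Require Import Defs.
From mathcomp Require Import all_boot all_order all_algebra.
From mathcomp Require Import all_classical all_reals all_analysis.
From mathcomp Require Import lra.
Import Order.TTheory GRing.Theory Num.Theory.
Import numFieldNormedType.Exports.
Local Open Scope classical_set_scope.
Local Open Scope ring_scope.

(** Local minimality does not depend on the admissible space, because it can be
    expressed through the reduced problem on [D] in R^k alone: [f] is an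
    [X]-local minimiser iff [f = T^-1 (T f)] and [T f] is a local minimiser of
    [F \o T^-1] on [D]. A local minimiser must minimise [F] on its own fibre by
    strict convexity along the segment to [T^-1 (T f)], which lies in [X]; the
    two notions of locality then match by continuity of [T^-1 : D -> X] and of
    [T : X -> R^k]. *)

Lemma convex_set_segment (R : realType) (V : normedModType R) (A : set V)
    (f g : V) (t : R) :
  convex_set A -> A f -> A g -> 0 < t < 1 -> A (t *: f + (1 - t) *: g).
Proof.
move=> cA Af Ag t01.
have i01 : Itv.spec (@Itv.num_sem R) (Itv.Real `[0%Z, 1%Z]) t.
  by rewrite /= /Itv.num_sem/= num_real /= in_itv/=; lra.
by have := cA f g (Itv.mk i01); rewrite !inE => /(_ Af Ag).
Qed.

Lemma feasible_image (R : realType) (V : normedModType R) (k : nat)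
    (U : set V) (T : {linear V -> 'rV[R]_k}) (F : V -> \bar R) (f : V) :
  U f -> (F f < +oo)%E -> feasible U T F (T f).
Proof. by move=> Uf Ff; exists f. Qed.

Lemma argmin_lty (R : realType) (V : normedModType R) (k : nat)
    (U : set V) (T : {linear V -> 'rV[R]_k}) (F : V -> \bar R)
    (b : 'rV[R]_k) (f : V) :
  feasible U T F b -> argmin U T F b f -> (F f < +oo)%E.
Proof. by move=> [g [Ug Fg] Tg] [_ minf]; apply: le_lt_trans Fg; apply: minf. Qed.

(** If [F (i y) < F f], strict convexity puts [F] strictly below [F f] on the open segment from [f]
    to [i y]. This segment is the image of one in [X], so it meets every [X]-ball around [f]. *)
Lemma local_minimiser_fibre_le (R : realType) (V : completeNormedModType R)
    (k : nat) (U : set V) (T : {linear V -> 'rV[R]_k}) (F : V -> \bar R)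
    (X : completeNormedModType R) (i : {linear X -> V}) (f : V) (y : X) :
  bounded_below U F ->
  convex_set (fibre U T (T f)) -> strictly_convex_on (fibre U T (T f)) F ->
  local_minimiser U F i f -> fibre U T (T f) (i y) -> (F f <= F (i y))%E.
Proof.
move=> [m mF] cv scv [x [ixf Uf Ff [e e0 minf]]] Ay.
rewrite leNgt; apply/negP => Fyf.
have Af : fibre U T (T f) f by [].
have yf : i y != f by apply: contraTneq Fyf => ->; rewrite ltxx.
(* The bound [1 / 2] keeps [t] below 1; the other gives [t * d < e], with [d + 1] keeping the
   denominator positive. *)
pose d := `|y - x|; pose t := Num.min (1 / 2) (e / (2 * (d + 1))).
have d0 : 0 <= d by exact: normr_ge0.
have d1 : 0 < 2 * (d + 1) by lra.
have t01 : 0 < t < 1.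
  have ed : 0 < e / (2 * (d + 1)) by rewrite divr_gt0.
  rewrite /t lt_min gt_min ed; lra.
have te : `|(t *: y + (1 - t) *: x) - x| < e.
  have -> : (t *: y + (1 - t) *: x) - x = t *: (y - x).
    by rewrite scalerBl scale1r addrA addrAC addrK scalerBr.
  rewrite normrZ gtr0_norm; last by case/andP: t01.
  have : t * (2 * (d + 1)) <= e.
    by rewrite -ler_pdivlMr// /t ge_min lexx orbT.
  case/andP: t01 => t0 _; rewrite -/d; nra.
have Aseg := convex_set_segment _ _ _ _ _ _ cv Ay Af t01.
have := scv _ _ t Ay Af (lt_trans Fyf Ff) Ff yf t01.
have := minf (t *: y + (1 - t) *: x).
rewrite linearD !linearZ /= ixf => /(_ Aseg.1 te) le1 lt1.
(* Both values are real, say [r] for [f] and [q] for [i y]; then [r < t * q + (1 - t) * r]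
   contradicts [q < r]. *)
have := le_lt_trans le1 lt1; move: Fyf Ff (mF _ Uf) (mF _ Ay.1).
case: (F f) => [r| |]//; case: (F (i y)) => [q| |]// + _ _ _.
rewrite -!EFinM -EFinD !lte_fin => qr; case/andP: t01 => t0 _; nra.
Qed.

(** The forward direction transports locality by continuity of [s], the converse by continuity of
    [T \o i]. *)
Lemma local_minimiserP (R : realType) (V : completeNormedModType R) (k : nat)
    (U : set V) (T : {linear V -> 'rV[R]_k}) (F : V -> \bar R)
    (X : completeNormedModType R) (i : {linear X -> V}) (f : V) :
  continuous T -> bounded_below U F -> weakly_coercive U F ->
  weakly_lsc U F ->
  (forall b, feasible U T F b -> convex_set (fibre U T b)) ->
  (forall b, feasible U T F b -> strictly_convex_on (fibre U T b) F) ->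
  admissible U T F i ->
  local_minimiser U F i f <->
  [/\ feasible U T F (T f), f = Defs.right_inverse U T F (T f) &
      \forall b \near within (feasible U T F) (nbhs (T f)),
        (F f <= F (Defs.right_inverse U T F b))%E].
Proof.
move=> cT bF coF lscF cv scv [injX _ cX [s [sE cs]]].
have rinvP b fb := @right_inverseP _ _ _ U T F b cT bF coF lscF cv scv fb.
have {}cs b : feasible U T F b ->
    s @ within (feasible U T F) (nbhs b) --> s b.
  by move: b; apply/subspace_continuousP.
split=> [lmf|[fTf fE minf]].
  have [x [ixf Uf Ff [e e0 minf]]] := lmf.
  have fTf : feasible U T F (T f) by exact: feasible_image.
  have [[Ar minr] uniqr] := rinvP _ fTf.
  have fE : f = Defs.right_inverse U T F (T f).
    (* A competitor [g] may lie outside [X], so [f] is compared with the fibre minimiser, which is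
       the image of [s (T f)]. *)
    apply: uniqr; split => // g Ag; apply: le_trans (minr _ Ag).
    rewrite -sE//; apply: local_minimiser_fibre_le (lmf) _ => //.
    - exact: cv.
    - exact: scv.
    - by rewrite sE.
  split => //.
  (* The centre of the ball is [s (T f)], so [s] maps feasible points near [T f] into that ball. *)
  have sx : s (T f) = x by apply: injX; rewrite sE// ixf -fE.
  have near_s : \forall b \near within (feasible U T F) (nbhs (T f)),
      `|x - s b| < e.
    by have /cvgrPdist_lt/(_ e e0) := cs _ fTf; rewrite sx.
  have near_feasible : \forall b \near within (feasible U T F) (nbhs (T f)),
      feasible U T F b by exact: withinT.
  apply: filterS2 near_feasible near_s => b fb sbx.
  rewrite -sE//; apply: minf; last by rewrite distrC.
  by rewrite sE//; case: (rinvP _ fb) => -[[]].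
have [am _] := rinvP _ fTf; rewrite -fE in am.
exists (s (T f)); rewrite sE// -fE; split => //.
- exact: am.1.1.
- exact: argmin_lty fTf am.
have cTi : {for s (T f), continuous (T \o i)}.
  by apply: continuous_comp; [exact: cX|exact: cT].
have : (T \o i) @ s (T f) --> T f by rewrite {2}fE -sE//; exact: cTi.
move=> /(_ _ minf)/nbhs_ballP[e /= e0 ballP]; exists e => // y Uy ye.
(* Finiteness of [F (i y)] makes [T (i y)] feasible; the minimiser on its fibre then has a value
   between [F f] and [F (i y)]. *)
have [Fy|] := ltP (F (i y)) +oo%E; last by apply: le_trans; exact: leey.
have fy : feasible U T F (T (i y)) by exact: feasible_image.
have [[_ miny] _] := rinvP _ fy.
apply: (le_trans _ (miny _ _)) => //.
by apply: ballP => //; rewrite -ball_normE /= distrC.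
Qed.

Theorem proposition4p6 (R : realType) (V : completeNormedModType R) (k : nat)
  (U : set V) (T : {linear V -> 'rV[R]_k}) (F : V -> \bar R)
  (T_continuous : continuous T)
  (F_bounded_below : bounded_below U F)
  (F_coercive : weakly_coercive U F)
  (F_lsc : weakly_lsc U F)
  (fibre_convex : forall b, feasible U T F b -> convex_set (fibre U T b))
  (F_strictly_convex : forall b, feasible U T F b ->
    strictly_convex_on (fibre U T b) F)
  (X X' : completeNormedModType R)
  (i : {linear X -> V}) (i' : {linear X' -> V})
  (X_admissible : admissible U T F i) (X'_admissible : admissible U T F i')
  (fstar : V) :
  local_minimiser U F i fstar <-> local_minimiser U F i' fstar.
Proof.
have P := local_minimiserP _ _ _ _ _ _ _ _ fstar T_continuous F_bounded_below
  F_coercive F_lsc fibre_convex F_strictly_convex.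
exact: iff_trans (P _ _ X_admissible) (iff_sym (P _ _ X'_admissible)).
Qed.
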